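(* Let $a$ be a positive integer and $b$ be any integer. For positive integers $k$ and integers $m$, let $r_k(m)$ denote the number of $k$-tuples $(x_1,\dots,x_k)\in\mathbb{Z}^k$ with $x_1^2+\cdots+x_k^2=m$. Then there are constants $A$ (depending only on $a$) and $B$ (depending on $a$ and $b$) such that \[ r_{n}(an+b) \sim \frac{B \cdot A^{n}}{\sqrt{n}} \quad \text{as } n\to\infty, \] where $f(n)\sim g(n)$ means $\lim_{n\to\infty} f(n)/g(n) = 1$.
   Context: $r_k(m)$ is the number of representations of $m$ as an ordered sum of $k$ squares of integers (signs and order counted), with $r_k(m)=0$ for $m<0$. *)

(* Defs.v *)
From HB Require Import structures.
From mathcomp Require Import all_boot all_order all_algebra finmap.
From mathcomp Require Import all_classical all_reals all_analysis.


Import Order.TTheory GRing.Theory Num.Theory.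
Import numFieldNormedType.Exports.

Local Open Scope classical_set_scope.
Local Open Scope ring_scope.

Definition sq_reps (k : nat) (m : int) : set (k.-tuple int) :=
  [set x | \sum_(i < k) tnth x i ^+ 2 = m].

(* [fset_set] is the empty set on an infinite argument; [sq_reps_finite] below
   shows that this case does not occur. *)
Definition r_ (k : nat) (m : int) : nat := #|` fset_set (sq_reps k m)|%fset.

Lemma sq_reps_finite (k : nat) (m : int) : finite_set (sq_reps k m).
Proof.
pose N := `|m|%N.
pose f (u : k.-tuple 'I_(N + N).+1) : k.-tuple int :=
  [tuple of map (fun j : 'I_(N + N).+1 => j%:Z - N%:Z) u].
apply: (@sub_finite_set _ _ (f @` setT)); last first.
  by apply: finite_image; exact: finite_finset.
move=> x /= xm.
have xle i : `|tnth x i| <= N%:Z.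
  have sq_le : tnth x i ^+ 2 <= m.
    by rewrite -xm (bigD1 i) //= lerDl sumr_ge0 // => j _; exact: sqr_ge0.
  have m0 : 0 <= m by apply: le_trans sq_le; exact: sqr_ge0.
  rewrite /N gez0_abs //; apply: le_trans sq_le.
  rewrite -real_normK ?num_real //.
  have [->|nz] := eqVneq (tnth x i) 0; first by rewrite normr0 expr0n.
  by rewrite expr2 ler_peMl // -gtz0_ge1 normr_gt0.
have x0 i : 0 <= tnth x i + N%:Z.
  by have := xle i; rewrite ler_norml => /andP[+ _]; rewrite -subr_ge0 opprK.
exists [tuple inord (absz (tnth x i + N%:Z)) | i < k] => //.
apply: eq_from_tnth => i; rewrite tnth_map tnth_mktuple inordK.
  by rewrite gez0_abs // addrK.
rewrite ltnS -lez_nat gez0_abs // PoszD lerD2r.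
by have := xle i; rewrite ler_norml => /andP[].
Qed.

(* Main.v *)
Require Import Defs.
From HB Require Import structures.
From mathcomp Require Import all_boot all_order all_algebra finmap.
From mathcomp Require Import all_classical all_reals all_analysis.
From mathcomp Require Import ring lra zify complex measurable_realfun.

Import Order.TTheory GRing.Theory Num.Theory.
Import numFieldNormedType.Exports.
Local Open Scope classical_set_scope.
Local Open Scope ring_scope.

Set Implicit Arguments.
Unset Strict Implicit.
Unset Printing Implicit Defensive.

(* Exponential tilting and a local limit theorem.  Choose [q] in [(0, 1)] such
   that the probability law on the integers proportional to [q ^ (x ^ 2)] gives
   [x ^ 2] the mean [a].  If [th] is its normalising constant then
   [r_n(m) q^m / th^n] is the probability that the sum of [n] independent squares
   equals [m]; for [m = a n + b] it is the mean over [[-pi, pi]] of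
   [exp(- i b t) psi(t)^n], with [psi] the characteristic function of [x ^ 2 - a].
   Substituting [t = s / sqrt n], the integrand tends to
   [exp (- sigma^2 s^2 / 2)].  It is dominated by a Gaussian because [x ^ 2] takes
   the consecutive values 0 and 1, so that [|psi(t)| <= exp (- kappa t^2)] for
   [|t| <= pi].  Hence [A = th / q^a]. *)

(** * Elementary limits and polynomial-times-geometric bounds *)

Lemma cvg_natrV (R : realType) : n%:R^-1 @[n --> \oo] --> (0 : R).
Proof.
apply/gtr0_cvgV0; last exact: cvgr_idn.
by near=> n; rewrite ltr0n; near: n; exact: nbhs_infty_gt.
Unshelve. all: by end_near. Qed.

Lemma cvg_sqrt_natrV (R : realType) :
  (Num.sqrt n%:R)^-1 @[n --> \oo] --> (0 : R).
Proof.
have -> : (fun n => (Num.sqrt n%:R)^-1) = (fun n => Num.sqrt n%:R^-1 : R).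
  by apply/funext => n; rewrite sqrtrV.
rewrite -(sqrtr0 R).
by apply: continuous_cvg; [exact: sqrt_continuous|exact: cvg_natrV].
Qed.

(** Induction on [m] with [q = p ^+ 2]: one factor [p ^+ j] pays for the first [m] powers by the
    induction hypothesis at [p]. The other pays for the last power, since [j * p ^+ j] is at most
    the sum of [p ^+ i] over [i < j]. *)
Lemma natrX_geometric_bounded (R : realType) (m : nat) (x q : R) :
  0 <= x -> 0 <= q < 1 ->
  exists C : R, forall j : nat, (j%:R + x) ^+ m * q ^+ j <= C.
Proof.
move=> x0; elim: m q => [|m IH] q /andP[q0 q1].
  by exists 1 => j; rewrite expr0 mul1r exprn_ile1 // ltW.
pose p := Num.sqrt q.
have p0 : 0 <= p by exact: sqrtr_ge0.
have p1 : p < 1 by rewrite -sqrtr1 ltr_sqrt.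
have [|C HC] := IH p; first by rewrite p0.
exists (C * ((1 - p)^-1 + x)) => j.
have -> : (j%:R + x) ^+ m.+1 * q ^+ j =
    ((j%:R + x) ^+ m * p ^+ j) * ((j%:R + x) * p ^+ j).
  by rewrite exprSr -[q]sqr_sqrtr // -/p exprAC expr2; ring.
have jp : j%:R * p ^+ j <= (1 - p)^-1.
  have [->|pn0] := eqVneq p 0.
    by rewrite subr0 invr1 expr0n; case: j => [|j]; rewrite ?mul0r ?mulr0 ler01.
  apply: (@le_trans _ _ (series (geometric 1 p) j)); last first.
    rewrite -[leRHS]mul1r; apply: geometric_le_lim => //; first by rewrite lt0r pn0.
    by rewrite ger0_norm.
  rewrite /series /= mulr_natl -[X in _ *+ X]subn0 -sumr_const_nat.
  apply: ler_sum_nat => i /andP[_ ij].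
  by rewrite mul1r ler_wiXn2l ?(ltW p1) // ltnW.
have jx0 : 0 <= j%:R + x by rewrite addr_ge0.
rewrite ler_pM // ?mulr_ge0 // ?exprn_ge0 // mulrDl lerD //.
by rewrite ler_piMr // exprn_ile1 // ltW.
Qed.

(* The number of integers of absolute value [j]. *)
Definition abs_mult (j : nat) : nat := if j == 0%N then 1%N else 2%N.

Lemma abs_mult_le2 (R : realType) j : (abs_mult j)%:R <= 2 :> R.
Proof. by rewrite ler_nat /abs_mult; case: eqP. Qed.

(** The common source of domination for the theta series and all its moments. As [j <= j ^ 2], the
    Gaussian factor is at most [q ^+ j = p ^+ j * p ^+ j]; one copy absorbs the polynomial, using
    [j ^ 2 + a <= (j + a) ^ 2], and the other is the geometric rate. *)
Lemma gaussian_moment_geometric (R : realType) (a m : nat) (q : R) :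
  0 < q < 1 -> exists C r : R, 0 < r < 1 /\
    forall j : nat,
      (abs_mult j)%:R * (j ^ 2 + a)%:R ^+ m * q ^+ (j ^ 2) <= C * r ^+ j.
Proof.
move=> /andP[q0 q1]; pose p := Num.sqrt q.
have p0 : 0 < p by rewrite sqrtr_gt0.
have p1 : p < 1 by rewrite -sqrtr1 ltr_sqrt.
have [||C HC] := @natrX_geometric_bounded R (2 * m) a%:R p.
- by [].
- by rewrite ltW.
exists (2 * C), p; split=> [|j]; first by rewrite p0.
rewrite -!mulrA; apply: ler_pM => //; last 2 first.
- exact: abs_mult_le2.
- apply: (@le_trans _ _ ((j%:R + a%:R) ^+ (2 * m) * q ^+ j)).
    apply: ler_pM.
    + by rewrite exprn_ge0.
    + by rewrite exprn_ge0 // ltW.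
    + rewrite exprM lerXn2r ?nnegrE ?ler0n ?sqr_ge0 //.
      by rewrite -natrD -natrX ler_nat; nia.
    + by rewrite ler_wiXn2l ?(ltW q0) ?(ltW q1) //; nia.
  have -> : q ^+ j = p ^+ j * p ^+ j by rewrite -exprMn -expr2 sqr_sqrtr // ltW.
  by rewrite mulrA ler_wpM2r // exprn_ge0 // ltW.
- by rewrite mulr_ge0 ?exprn_ge0 // ltW.
Qed.

Lemma cvg_natr_geometric (R : realType) (q : R) : 0 < q < 1 ->
  n%:R * q ^+ n @[n --> \oo] --> (0 : R).
Proof.
move=> /andP[q0 q1]; pose p := Num.sqrt q.
have p0 : 0 < p by rewrite sqrtr_gt0.
have p1 : p < 1 by rewrite -sqrtr1 ltr_sqrt.
have [||C HC] := @natrX_geometric_bounded R 1 0 p; [by []|by rewrite ltW|].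
apply: (@squeeze_cvgr _ _ _ _ (fun=> 0) (geometric C p)).
- near=> n; rewrite mulr_ge0 //= ?exprn_ge0 ?(ltW q0) //.
  have -> : q ^+ n = p ^+ n * p ^+ n by rewrite -exprMn -expr2 sqr_sqrtr // ltW.
  rewrite mulrA ler_wpM2r //.
    by rewrite exprn_ge0 // ltW.
  by rewrite -[n%:R]expr1 -[n%:R]addr0.
- exact: cvg_cst.
- by apply: cvg_geometric; rewrite gtr0_norm.
Unshelve. all: by end_near. Qed.

(** * Series dominated by a geometric series *)

Section geometrically_bounded_series.
Context {R : realType}.
Variables (f : R^nat) (C r : R).
Hypotheses (r01 : 0 < r < 1) (fle : forall j, `|f j| <= C * r ^+ j).

Lemma is_cvg_series_geometric_bound : cvgn (series f).
Proof.
apply: normed_cvg; apply: (@series_le_cvg _ _ (geometric C r)) => //.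
- by move=> n /=.
- by move=> n; exact: le_trans (normr_ge0 _) (fle n).
- by apply: is_cvg_geometric_series; case/andP: r01 => r0 r1; rewrite gtr0_norm.
Qed.

Lemma series_geometric_tail N :
  `|limn (series f) - series f N| <= C * r ^+ N / (1 - r).
Proof.
have /andP[r0 r1] := r01.
have cv : series f n - series f N @[n --> \oo] --> limn (series f) - series f N.
  by apply: cvgB; [exact: is_cvg_series_geometric_bound|exact: cvg_cst].
rewrite -(cvg_lim _ (cvg_norm cv)) //.
apply: limr_le; first by apply: cvgP; exact: (cvg_norm cv).
near=> n; rewrite (sub_series f) ifT; last by near: n; exact: nbhs_infty_ge.
have Nn : (N <= n)%N by near: n; exact: nbhs_infty_ge.
apply: (le_trans (ler_norm_sum _ _ _)).
apply: (@le_trans _ _ (\sum_(N <= k < n) C * r ^+ k)).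
  by apply: ler_sum => i _; exact: fle.
rewrite -mulr_sumr -mulrA ler_wpM2l //.
  by have := le_trans (normr_ge0 _) (fle 0%N); rewrite expr0 mulr1.
rewrite -(subnKC Nn) geometric_partial_tail.
by apply: geometric_le_lim; rewrite ?exprn_ge0 ?(ltW r0) // gtr0_norm.
Unshelve. all: by end_near. Qed.

(** Truncating a moment series at an index at least [n] costs [o(1/n)], which is negligible even
    after the factor [n] of the central limit scaling. *)
Lemma cvg_natr_series_geometric_tail (N : nat -> nat) :
  (forall n, n <= N n)%N ->
  n%:R * (limn (series f) - series f (N n)) @[n --> \oo] --> (0 : R).
Proof.
move=> nN; have /andP[r0 r1] := r01; apply/norm_cvg0P.
have C0 : 0 <= C by have := le_trans (normr_ge0 _) (fle 0%N); rewrite expr0 mulr1.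
apply: (@squeeze_cvgr _ _ _ _ (fun=> 0)
  (fun n => C / (1 - r) * (n%:R * r ^+ n))).
- near=> n; rewrite normr_ge0 /= normrM normr_nat.
  rewrite [leRHS](_ : _ = n%:R * (C * r ^+ n / (1 - r))); last by ring.
  rewrite ler_wpM2l // (le_trans (series_geometric_tail _)) //.
  rewrite ler_wpM2r ?invr_ge0 ?subr_ge0 ?(ltW r1) // ler_wpM2l //.
  by rewrite ler_wiXn2l // ltW.
- exact: cvg_cst.
- rewrite -[X in _ --> X](mulr0 (C / (1 - r))).
  by apply: cvgMr; exact: cvg_natr_geometric.
Unshelve. all: by end_near. Qed.

End geometrically_bounded_series.

(** * Taylor bounds for sine and cosine *)

Lemma is_derive_continuous (R : realType) (f df : R -> R) :
  (forall x : R, is_derive x 1 f (df x)) -> continuous f.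
Proof.
by move=> fdf y; apply/differentiable_continuous/derivable1_diffP; case: (fdf y).
Qed.

(** Drives the chain of Taylor bounds below: each difference vanishes at 0 and has the preceding
    difference as its derivative. *)
Lemma derive_ge0_ge0 (R : realType) (f df : R -> R) :
  (forall x : R, is_derive x 1 f (df x)) -> f 0 = 0 ->
  (forall x, 0 <= x -> 0 <= df x) -> forall x, 0 <= x -> 0 <= f x.
Proof.
move=> fdf f0 df0 x x0.
have fc := is_derive_continuous fdf.
have [|c /andP[c0 _]] := @MVT_segment R f df 0 x x0 (fun y _ => fdf y).
- exact: continuous_subspaceT.
- by rewrite f0 !subr0 => ->; rewrite mulr_ge0 // df0.
Qed.

Lemma sin_le_id (R : realType) (x : R) : 0 <= x -> sin x <= x.
Proof.
move=> x0; rewrite -subr_ge0.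
apply: (@derive_ge0_ge0 R (fun x => x - sin x) (fun x => 1 - cos x)) => //.
by rewrite sin0 subr0.
Qed.

Lemma cos_ge_taylor2 (R : realType) (x : R) : 1 - x ^+ 2 / 2 <= cos x.
Proof.
wlog x0 : x / 0 <= x.
  move=> H; have [|/ltW x0] := leP 0 x; first exact: H.
  by rewrite -cosN -sqrrN; apply: H; rewrite oppr_ge0.
rewrite -subr_ge0.
apply: (@derive_ge0_ge0 R (fun x => cos x - (1 - x ^+ 2 / 2))
          (fun x => x - sin x)) => //.
- move=> y; apply: is_derive_eq; rewrite /GRing.scale /=; lra.
- by rewrite cos0; lra.
- by move=> y y0; rewrite subr_ge0 sin_le_id.
Qed.

Lemma sin_ge_taylor3 (R : realType) (x : R) : 0 <= x -> x - x ^+ 3 / 6 <= sin x.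
Proof.
move=> x0; rewrite -subr_ge0.
apply: (@derive_ge0_ge0 R (fun x => sin x - (x - x ^+ 3 / 6))
          (fun x => cos x - (1 - x ^+ 2 / 2))) => //.
- move=> y; apply: is_derive_eq; rewrite /GRing.scale /=; lra.
- by rewrite sin0; lra.
- by move=> y y0; rewrite subr_ge0 cos_ge_taylor2.
Qed.

Lemma cos_le_taylor4 (R : realType) (x : R) :
  cos x <= 1 - x ^+ 2 / 2 + x ^+ 4 / 24.
Proof.
wlog x0 : x / 0 <= x.
  move=> H; have [|/ltW x0] := leP 0 x; first exact: H.
  have := H (- x); rewrite oppr_ge0 => /(_ x0); rewrite cosN sqrrN.
  by rewrite (exprNn x 4) -signr_odd mul1r.
rewrite -subr_ge0.
apply: (@derive_ge0_ge0 R (fun x => 1 - x ^+ 2 / 2 + x ^+ 4 / 24 - cos x)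
          (fun x => sin x - (x - x ^+ 3 / 6))) => //.
- move=> y; apply: is_derive_eq; rewrite /GRing.scale /=; lra.
- by rewrite cos0; lra.
- by move=> y y0; rewrite subr_ge0 sin_ge_taylor3.
Qed.

Lemma cos_taylor (R : realType) (x : R) :
  `|cos x - (1 - x ^+ 2 / 2)| <= x ^+ 4.
Proof.
rewrite ger0_norm ?subr_ge0 ?cos_ge_taylor2 //.
have := cos_le_taylor4 x; have : 0 <= x ^+ 4 by rewrite exprn_even_ge0.
lra.
Qed.

Lemma sin_taylor (R : realType) (x : R) : `|sin x - x| <= `|x| ^+ 3.
Proof.
wlog x0 : x / 0 <= x.
  move=> H; have [|/ltW x0] := leP 0 x; first exact: H.
  have := H (- x); rewrite oppr_ge0 => /(_ x0).
  by rewrite sinN normrN -opprD normrN.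
rewrite distrC ger0_norm ?subr_ge0 ?sin_le_id // ger0_norm //.
have := sin_ge_taylor3 x0; have : 0 <= x ^+ 3 by rewrite exprn_ge0.
lra.
Qed.

(** With [y = |x| / 2], [cos x = 1 - 2 sin(y)^2]. On [[0, 2]], which contains [[0, pi / 2]], the
    cubic bound gives [sin y >= y - y^3 / 6 >= y / 3], and [2 (|x| / 6)^2 = x^2 / 18]. *)
Lemma cos_le_quadratic (R : realType) (x : R) :
  `|x| <= pi -> cos x <= 1 - x ^+ 2 / 18.
Proof.
move=> xpi; rewrite -cos_norm -real_normK ?num_real //.
set y := `|x| / 2; have -> : `|x| = y *+ 2 by rewrite /y -mulr_natr; field.
have y0 : 0 <= y by rewrite /y divr_ge0.
have y2 : y <= 2.
  by rewrite (le_trans _ (ltW (pihalf_lt2 R))) // /y ler_wpM2r.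
have siny : y / 3 <= sin y.
  apply: (le_trans _ (sin_ge_taylor3 y0)).
  have : 0 <= y * (2 - y) * (2 + y) by rewrite !mulr_ge0 ?subr_ge0 // addr_ge0.
  rewrite !exprS expr0; lra.
rewrite cos_mulr2n cos2sin2.
have : (y / 3) ^+ 2 <= sin y ^+ 2.
  by rewrite ler_sqr // ?nnegrE ?(le_trans _ siny) // divr_ge0.
rewrite -mulr_natr; lra.
Qed.

(** * Unit complex numbers, powers and modulus bounds *)

Section cis.
Context {R : realType}.
Import Normc.
Local Open Scope complex_scope.
Implicit Types (z w : R[i]) (s t : R).

Definition cis t : R[i] := cos t +i* sin t.

Lemma cis0 : cis 0 = 1.
Proof. by rewrite /cis cos0 sin0. Qed.

Lemma cisD s t : cis (s + t) = cis s * cis t.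
Proof.
by rewrite /cis cosD sinD; simpc; congr (_ +i* _); rewrite addrC [X in X + _]mulrC.
Qed.

Lemma cis_sum (I : Type) (r : seq I) (P : pred I) (f : I -> R) :
  cis (\sum_(i <- r | P i) f i) = \prod_(i <- r | P i) cis (f i).
Proof. exact: (big_morph cis cisD cis0). Qed.

Lemma cis_natM n t : cis (n%:R * t) = cis t ^+ n.
Proof.
elim: n => [|n IH]; first by rewrite mul0r cis0.
by rewrite -natr1 mulrDl mul1r cisD IH exprSr.
Qed.

Lemma normc_cis t : normc (cis t) = 1.
Proof. by rewrite /= cos2Dsin2 sqrtr1. Qed.

Lemma Re_sum (I : Type) (r : seq I) (P : pred I) (f : I -> R[i]) :
  complex.Re (\sum_(i <- r | P i) f i) = \sum_(i <- r | P i) complex.Re (f i).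
Proof. by apply: (big_morph (@complex.Re R)) => // -[? ?] []. Qed.

Lemma Im_sum (I : Type) (r : seq I) (P : pred I) (f : I -> R[i]) :
  complex.Im (\sum_(i <- r | P i) f i) = \sum_(i <- r | P i) complex.Im (f i).
Proof. by apply: (big_morph (@complex.Im R)) => // -[? ?] []. Qed.

Lemma Re_realM s z : complex.Re (s%:C * z) = s * complex.Re z.
Proof. by case: z => x y /=; rewrite mul0r subr0. Qed.

Lemma Im_realM s z : complex.Im (s%:C * z) = s * complex.Im z.
Proof. by case: z => x y /=; rewrite mul0r addr0. Qed.

Lemma normc_real s : normc s%:C = `|s|.
Proof. by rewrite /= expr0n addr0 sqrtr_sqr. Qed.

Lemma normcX n z : normc (z ^+ n) = normc z ^+ n.
Proof.
by elim: n => [|n IH]; rewrite ?expr0 ?normc1 // !exprS normcM IH.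
Qed.

Lemma normc_ge0 z : 0 <= normc z.
Proof. by case: z => x y; exact: sqrtr_ge0. Qed.

Lemma ler_normc_sum (I : Type) (r : seq I) (P : pred I) (f : I -> R[i]) :
  normc (\sum_(i <- r | P i) f i) <= \sum_(i <- r | P i) normc (f i).
Proof.
elim/big_ind2: _ => [|x1 x2 y1 y2 h1 h2|i _]; rewrite ?normc0 //.
by apply: le_trans (le_normcD _ _) _; rewrite lerD.
Qed.

Lemma ler_normRe z : `|complex.Re z| <= normc z.
Proof.
case: z => x y /=; rewrite -sqrtr_sqr ler_sqrt ?addr_ge0 ?sqr_ge0 //.
by rewrite lerDl sqr_ge0.
Qed.

Lemma normc_le_ReIm z : normc z <= `|complex.Re z| + `|complex.Im z|.
Proof.
have -> : z = (complex.Re z)%:C + (complex.Im z)%:C * 'i.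
  by case: z => x y; simpc.
apply: (le_trans (le_normcD _ _)); rewrite normcM !normc_real.
have -> : normc ('i : R[i]) = 1 by rewrite /= expr0n expr1n add0r sqrtr1.
by rewrite mulr1 /= !mul0r !mulr1 !mulr0 ?subr0 ?addr0 ?add0r.
Qed.

Lemma normc_subXX n z w : normc z <= 1 -> normc w <= 1 ->
  normc (z ^+ n - w ^+ n) <= n%:R * normc (z - w).
Proof.
move=> z1 w1; elim: n => [|n IH]; first by rewrite subrr normc0 mul0r.
have -> : z ^+ n.+1 - w ^+ n.+1 = z * (z ^+ n - w ^+ n) + (z - w) * w ^+ n.
  by rewrite !exprS; ring.
apply: (le_trans (le_normcD _ _)); rewrite !normcM -natr1 mulrDl mul1r lerD //.
  by rewrite (le_trans _ IH) // ler_piMl // normc_ge0.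
by rewrite ler_piMr ?normc_ge0 // normcX exprn_ile1 ?normc_ge0.
Qed.

Lemma expR_sub1_bound (x : R) : x <= 0 -> `|expR x - 1 - x| <= x ^+ 2.
Proof.
move=> x0; have ex := expR_ge1Dx x; rewrite ger0_norm; last by lra.
have e1 : expR x * (1 - x) <= 1.
  rewrite -[leRHS](expR0) -[in leRHS](subrr x) expRD ler_wpM2l ?expR_ge0 //.
  exact: expR_ge1Dx.
by have := expR_gt0 x; nra.
Qed.

(* [|z^n - w^n| <= n |z - w|] in the unit disk, with [w = expR (L / n)]. *)
Lemma cvg_Re_cis_exp (z : nat -> R[i]) (beta : nat -> R) (L : R) :
  (forall n, normc (z n) <= 1) -> L <= 0 ->
  n%:R * (complex.Re (z n) - 1) @[n --> \oo] --> L ->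
  n%:R * complex.Im (z n) @[n --> \oo] --> (0 : R) ->
  beta n @[n --> \oo] --> (0 : R) ->
  complex.Re (cis (beta n) * z n ^+ n) @[n --> \oo] --> expR L.
Proof.
move=> z1 L0 zRe zIm b0; apply/subr_cvg0/norm_cvg0P.
(* The first two terms bound the effect of the factor [cis (beta n)]. The others bound [n] times the
   distance from [z n] to [w], split into real and imaginary parts, with the second-order error of
   the exponential as [L ^+ 2 / n]. *)
pose d n := `|cos (beta n) - 1| + `|sin (beta n)|
  + (`|n%:R * (complex.Re (z n) - 1) - L| + L ^+ 2 / n%:R
     + `|n%:R * complex.Im (z n)|).
apply: (@squeeze_cvgr _ _ _ _ (fun=> 0) d); [|exact: cvg_cst|].
- near=> n; rewrite normr_ge0 /=.
  have n0 : (0 < n)%N by near: n; exact: nbhs_infty_gt.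
  have nR0 : n%:R != 0 :> R by rewrite pnatr_eq0 -lt0n.
  pose w : R[i] := (expR (L / n%:R))%:C.
  have wX : w ^+ n = (expR L)%:C.
    by rewrite -rmorphXn /= -expRM_natl mulrC divfK.
  have w1 : normc w <= 1.
    rewrite normc_real gtr0_norm ?expR_gt0 // -expR0 ler_expR.
    by rewrite mulr_le0_ge0.
  have -> : complex.Re (cis (beta n) * z n ^+ n) - expR L =
      complex.Re ((cis (beta n) - 1) * z n ^+ n + (z n ^+ n - w ^+ n)).
    rewrite wX mulrBl mul1r addrA subrK.
    by case: (_ * _) => x y.
  apply: (le_trans (ler_normRe _)); apply: (le_trans (le_normcD _ _)).
  rewrite /d lerD //.
    rewrite normcM normcX -[leRHS]mulr1 ler_pM ?normc_ge0 ?exprn_ge0 ?normc_ge0 //.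
      by apply: (le_trans (normc_le_ReIm _)); rewrite /= subr0.
    by rewrite exprn_ile1 ?normc_ge0.
  apply: (le_trans (normc_subXX _ (z1 n) w1)).
  rewrite -[n%:R in leLHS]ger0_norm //.
  apply: (@le_trans _ _ (`|n%:R * complex.Re (z n - w)| + `|n%:R * complex.Im (z n - w)|)).
    by rewrite !normrM -mulrDr ler_wpM2l // normc_le_ReIm.
  have -> : complex.Im (z n - w) = complex.Im (z n) by case: (z n) => x y /=; rewrite subr0.
  have -> : complex.Re (z n - w) = complex.Re (z n) - expR (L / n%:R) by case: (z n) => x y.
  rewrite lerD2r.
  have -> : n%:R * (complex.Re (z n) - expR (L / n%:R)) =
    n%:R * (complex.Re (z n) - 1) - L - n%:R * (expR (L / n%:R) - 1 - L / n%:R).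
    by field.
  rewrite (le_trans (ler_normB _ _)) // lerD2l normrM ger0_norm //.
  have -> : L ^+ 2 / n%:R = n%:R * (L / n%:R) ^+ 2 by field.
  rewrite ler_wpM2l // expR_sub1_bound //.
  by rewrite mulr_le0_ge0.
- have -> : (0 : R) = `|cos 0 - 1| + `|sin 0| + (`|L - L| + L ^+ 2 * 0 + `|0 : R|).
    by rewrite cos0 sin0 !subrr normr0 mulr0 !addr0.
  apply: cvgD; [apply: cvgD|apply: cvgD; [apply: cvgD|]]; try apply: cvg_norm.
  + apply: cvgB; last exact: cvg_cst.
    by apply: continuous_cvg => //; exact: continuous_cos.
  + by apply: continuous_cvg => //; exact: continuous_sin.
  + by apply: cvgB => //; exact: cvg_cst.
  + by apply: cvgMr; exact: cvg_natrV.
  + exact: zIm.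
Unshelve. all: by end_near. Qed.

(** All the cancellation is taken from the first two terms, whose frequencies differ by exactly 1;
    the remaining terms are bounded by the triangle inequality. *)
Lemma normc_cis_sum_le (w y : nat -> R) (N : nat) (t : R) :
  (forall j, 0 <= w j) -> 0 < w 0%N -> 0 < w 1%N -> y 1%N = y 0%N + 1 ->
  \sum_(j < N.+2) w j <= 1 -> `|t| <= pi ->
  normc (\sum_(j < N.+2) (w j)%:C * cis (y j * t))
    <= 1 - w 0%N * w 1%N / (w 0%N + w 1%N) / 18 * t ^+ 2.
Proof.
move=> w0 w0_gt0 w1_gt0 y01; rewrite !big_ord_recl /= /bump /= !add1n => w_le1 tpi.
have c0_gt0 : 0 < w 0%N + w 1%N by rewrite addr_gt0.
(* With [S = w 0 + w 1], the squared modulus of the two-term sum is [S^2 - 2 K S], which is at most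
   [(S - K)^2]. The bound [cos_le_quadratic] then turns [K] into a multiple of [t ^+ 2]. *)
pose K := w 0%N * w 1%N * (1 - cos t) / (w 0%N + w 1%N).
have K0 : 0 <= K.
  by rewrite divr_ge0 ?(ltW c0_gt0) // !mulr_ge0 // subr_ge0 cos_le1.
have Kw : K <= w 0%N + w 1%N.
  rewrite /K ler_pdivrMr //.
  have := cos_geN1 t; have := cos_le1 t.
  have : 0 <= w 0%N * w 1%N by rewrite mulr_ge0.
  by have := sqr_ge0 (w 0%N); have := sqr_ge0 (w 1%N); nra.
have two : normc ((w 0%N)%:C + (w 1%N)%:C * cis t) <= w 0%N + w 1%N - K.
  have -> : (w 0%N)%:C + (w 1%N)%:C * cis t = (w 0%N + w 1%N * cos t) +i* (w 1%N * sin t).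
    by rewrite /cis; simpc.
  rewrite /= -[leRHS]ger0_norm ?subr_ge0 // -sqrtr_sqr ler_wsqrtr //.
  have -> : (w 0%N + w 1%N * cos t) ^+ 2 + (w 1%N * sin t) ^+ 2 =
    (w 0%N + w 1%N) ^+ 2 - 2 * w 0%N * w 1%N * (1 - cos t).
    rewrite [(w 1%N * sin t) ^+ 2]exprMn sin2cos2; ring.
  have -> : 2 * w 0%N * w 1%N * (1 - cos t) = 2 * K * (w 0%N + w 1%N).
    by rewrite /K; field; rewrite gt_eqF.
  by have := sqr_ge0 K; lra.
rewrite addrA; apply: (le_trans (le_normcD _ _)).
have -> : (w 0%N)%:C * cis (y 0%N * t) + (w 1%N)%:C * cis (y 1%N * t) =
    ((w 0%N)%:C + (w 1%N)%:C * cis t) * cis (y 0%N * t).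
  by rewrite y01 mulrDl mul1r cisD; ring.
rewrite normcM normc_cis mulr1.
apply: (@le_trans _ _ (w 0%N + w 1%N - K + \sum_(i < N) w i.+2)).
  apply: lerD => //; apply: (le_trans (ler_normc_sum _ _ _)).
  by apply: ler_sum => i _; rewrite normcM normc_cis normc_real ger0_norm ?mulr1.
have KE : w 0%N * w 1%N / (w 0%N + w 1%N) / 18 * t ^+ 2 <= K.
  rewrite /K -[leLHS]mulrA [leRHS]mulrAC ler_wpM2l //.
    by rewrite divr_ge0 ?(ltW c0_gt0) // mulr_ge0.
  by have := cos_le_quadratic tpi; lra.
move: w_le1; rewrite addrA; under eq_bigr do rewrite !add1n.
lra.
Qed.

End cis.

(** * Existence of the tilting parameter *)

Lemma ler_norm_subXX (R : realType) (x y r : R) n :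
  0 <= x <= r -> 0 <= y <= r ->
  `|x ^+ n.+1 - y ^+ n.+1| <= n.+1%:R * r ^+ n * `|x - y|.
Proof.
move=> /andP[x0 xr] /andP[y0 yr]; rewrite subrXX normrM mulrC ler_wpM2r //.
apply: (le_trans (ler_norm_sum _ _ _)).
rewrite mulr_natl -[X in _ *+ X]card_ord -sumr_const; apply: ler_sum => i _.
rewrite /= ger0_norm ?mulr_ge0 ?exprn_ge0 //.
have -> : r ^+ n = r ^+ (n - i) * r ^+ i by rewrite -exprD subnK // -ltnS.
by rewrite ler_pM ?exprn_ge0 // lerXn2r // nnegrE (le_trans x0).
Qed.

Lemma lipschitz_within_continuous (R : realType) (f : R -> R) (A : set R) (L : R) :
  (forall x y, A x -> A y -> `|f x - f y| <= L * `|x - y|) ->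
  {within A, continuous f}.
Proof.
move=> fL; apply/subspace_continuousP => x Ax.
apply/cvgrPdist_lt => e e0; rewrite near_withinE.
have L0 : 0 < `|L| + 1 by rewrite ltr_wpDl.
near=> y => Ay; apply: (le_lt_trans (fL _ _ Ax Ay)).
apply: (@le_lt_trans _ _ ((`|L| + 1) * `|x - y|)).
  by rewrite ler_wpM2r // (le_trans (ler_norm _)) // lerDl.
rewrite -ltr_pdivlMl //.
by near: y; apply: cvgr_dist_lt => //; rewrite mulr_gt0 // invr_gt0.
Unshelve. all: by end_near. Qed.

Section tilt.
Context {R : realType}.
Variable a : nat.
Hypothesis a_gt0 : (0 < a)%N.

(** With the integers [j] and [-j] grouped, these are the terms of [x theta'(x) - a theta(x)], whose
    zero in [(0, 1)] is sought. *)
Definition tilt_term (x : R) (j : nat) : R :=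
  (abs_mult j)%:R * ((j ^ 2)%:R - a%:R) * x ^+ (j ^ 2).

Lemma norm_sqr_sub_le (j : nat) : `|(j ^ 2)%:R - a%:R| <= (j ^ 2 + a)%:R :> R.
Proof. by rewrite natrD (le_trans (ler_normB _ _)) // !normr_nat. Qed.

Let tilt_term_ge0 (x : R) j : 0 <= x -> (a <= j)%N -> 0 <= tilt_term x j.
Proof.
move=> x0 aj; rewrite /tilt_term !mulr_ge0 ?exprn_ge0 // subr_ge0 ler_nat.
by rewrite (leq_trans aj) // -mulnn; case: j {aj} => // j; rewrite leq_pmulr.
Qed.

(** At 1 the series diverges to infinity, as its terms are at least 1 beyond index [a]. A finite
    partial sum is used because it remains meaningful at 1 and depends continuously on the point. *)
Let partial_tilt_gt0 : exists2 N, (a < N)%N & 0 < series (tilt_term 1) N.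
Proof.
pose M := a.+1; pose s := series (tilt_term 1) M.
have grow k : s + k%:R <= series (tilt_term 1) (M + k)%N.
  elim: k => [|k IH]; first by rewrite addr0 addn0.
  rewrite addnS seriesSr -natr1 addrA addrC [leRHS]addrC lerD //.
  have c1 : 1 <= (abs_mult (M + k))%:R :> R by rewrite ler1n.
  have j1 : 1 <= ((M + k) ^ 2)%:R - a%:R :> R.
    by rewrite lerBrDr nat1r ler_nat /M; nia.
  by rewrite /tilt_term expr1n mulr1 (le_trans j1) // ler_peMl // (le_trans _ j1).
exists (M + (Num.trunc `|s|).+1)%N; first by rewrite /M; lia.
apply: lt_le_trans (grow _).
have := truncnS_gt `|s|; have : - s <= `|s| by rewrite -normrN ler_norm.
lra.
Qed.

(* The mean of [x ^ 2] under the weights [q ^ (x ^ 2)], [x : int], is [a]. *)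
Lemma exists_tilt : exists2 q : R, 0 < q < 1 & limn (series (tilt_term q)) = 0.
Proof.
have [N aN hN] := partial_tilt_gt0.
(* The partial sum is a polynomial in [x], so its positivity at 1 persists slightly to the left of
   1, where the full series converges. *)
have [x1 /andP[x10 x11] hx1] : exists2 x, 0 < x < 1 & 0 < series (tilt_term x) N.
  have cv : series (tilt_term x) N @[x --> (1 : R)^'-] --> series (tilt_term 1) N.
    apply: cvg_at_left_filter; elim: N {aN hN} => [|N IH].
      by rewrite /series /= !big_geq //; under eq_cvg do rewrite big_geq //; exact: cvg_cst.
    rewrite seriesSr; under eq_cvg do rewrite seriesSr.
    by apply: cvgD => //; apply: cvgMr; exact: exprn_continuous.
  near (1 : R)^'- => x; exists x.
    by apply/andP; split; near: x; [exact: nbhs_left_gt|exact: nbhs_left_lt].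
  near: x; exact: (cvgr_gt _ cv).
have x101 : 0 < x1 < 1 by rewrite x10.
have [C1 [r1 [r101 b1]]] := @gaussian_moment_geometric R a 1 x1 x101.
have tb x : 0 <= x <= x1 -> forall j, `|tilt_term x j| <= C1 * r1 ^+ j.
  move=> /andP[x0 xx1] j; apply: le_trans (b1 j).
  rewrite /tilt_term !normrM normr_nat -!mulrA ler_wpM2l //.
  rewrite ler_pM ?expr1 ?norm_sqr_sub_le // ger0_norm ?exprn_ge0 //.
  by rewrite lerXn2r ?nnegrE // ltW.
have cvt x : 0 <= x <= x1 -> cvgn (series (tilt_term x)).
  by move=> /tb; exact: is_cvg_series_geometric_bound.
pose H x := limn (series (tilt_term x)).
(* Only the term [j = 0] survives at 0, because [0 ^+ 0 = 1]. *)
have H0 : H 0 = - a%:R.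
  apply/cvg_lim => //; rewrite -(cvg_shiftS _) /=.
  apply: cvg_near_cst; near=> n.
  rewrite /series /= big_nat_recl // big1_seq ?addr0.
    by rewrite /tilt_term /abs_mult /= expr0 mulr1 mul1r sub0r.
  by move=> i _; rewrite /tilt_term expr0n /= mulr0.
(* Since [N > a], every term after the partial sum is nonnegative, so the limit is no smaller. *)
have H1 : 0 < H x1.
  apply: (lt_le_trans hx1); apply: limr_ge; first by apply: cvt; rewrite lexx ltW.
  near=> n; have Nn : (N <= n)%N by near: n; exact: nbhs_infty_ge.
  rewrite -subr_ge0 sub_series Nn big_nat sumr_ge0 // => i /andP[Ni _].
  by rewrite tilt_term_ge0 ?(ltW x10) // (leq_trans (ltnW aN)).
have [C2 [r2 [r201 b2]]] := @gaussian_moment_geometric R a 2 x1 x101.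
have C20 : 0 <= C2.
  by rewrite -[C2]mulr1 -(expr0 r2) (le_trans _ (b2 0%N)) // !mulr_ge0.
(* Continuity for the intermediate value theorem. Differencing a power of exponent [j ^ 2] costs a
   factor [j ^ 2], whence the second moment bound [b2], and lowers the exponent by one, whence the
   division by [x1]. *)
have HL x y : 0 <= x <= x1 -> 0 <= y <= x1 ->
    `|H x - H y| <= C2 / (1 - r2) / x1 * `|x - y|.
  move=> hx hy.
  have cv : series (tilt_term x) n - series (tilt_term y) n @[n --> \oo] --> H x - H y.
    by apply: cvgB; exact: cvt.
  rewrite -(cvg_lim _ (cvg_norm cv)) //.
  apply: limr_le; first by apply: cvgP; exact: (cvg_norm cv).
  near=> n; rewrite /series /= -sumrB (le_trans (ler_norm_sum _ _ _)) //.
  apply: (@le_trans _ _ (\sum_(0 <= j < n) C2 * r2 ^+ j / x1 * `|x - y|)).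
    apply: ler_sum => j _; case: j => [|j].
      by rewrite /tilt_term subrr normr0 !mulr_ge0 ?invr_ge0 ?(ltW x10) // expr0.
    rewrite /tilt_term -mulrBr normrM.
    have [k kE] : exists k, (j.+1 ^ 2)%N = k.+1 by exists ((j.+1 ^ 2).-1)%N; rewrite prednK.
    rewrite kE; apply: (@le_trans _ _ ((abs_mult j.+1)%:R * (j.+1 ^ 2 + a)%:R *
      (k.+1%:R * x1 ^+ k * `|x - y|))).
      rewrite ler_pM ?mulr_ge0 ?ler_norm_subXX //.
      by rewrite normrM normr_nat ler_wpM2l // -kE norm_sqr_sub_le.
    rewrite 2!mulrA ler_wpM2r // ler_pdivlMr //.
    apply: le_trans (b2 j.+1); rewrite kE -!mulrA -exprSr ler_wpM2l //.
    rewrite ler_wpM2l // ler_wpM2r ?exprn_ge0 ?(ltW x10) //.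
    by rewrite ler_nat leq_addr.
  rewrite -!mulr_suml ler_wpM2r // ler_wpM2r ?invr_ge0 ?(ltW x10) //.
  have /andP[r20 r21] := r201.
  by apply: geometric_le_lim => //; rewrite gtr0_norm.
have [||c cI Hc] := @IVT _ H 0 x1 0 (ltW x10).
- apply: (@lipschitz_within_continuous _ _ _ (C2 / (1 - r2) / x1)) => x y /=.
  by rewrite !in_itv /=; exact: HL.
- have Ha : - a%:R < 0 :> R by rewrite oppr_lt0 ltr0n.
  by rewrite H0 ge_min le_max (ltW Ha) (ltW H1) orbT.
exists c => //; move: cI; rewrite in_itv /= => /andP[c0 cx1].
rewrite (le_lt_trans cx1) // andbT lt0r c0 andbT.
apply/eqP => cE; move: Hc; rewrite cE H0 => /eqP.
by rewrite oppr_eq0 pnatr_eq0 => /eqP aE; move: a_gt0; rewrite aE.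
Unshelve. all: by end_near. Qed.

End tilt.

(** * Representations as points of a finite box *)

Lemma sum_abs_fold (V : nmodType) (f : nat -> V) (N : nat) :
  \sum_(i < (N + N).+1) f (absz (i%:Z - N%:Z)) = \sum_(j < N.+1) f j *+ abs_mult j.
Proof.
rewrite -(big_mkord xpredT (fun i => f (absz (i%:Z - N%:Z)))).
(* Split at the centre: the lower part, reversed, has absolute values [1, ..., N], and the upper
   part [0, ..., N]. *)
rewrite (@big_cat_nat _ _ _ N) /=; [|by []|by rewrite ltnW // ltnS leq_addr].
rewrite big_nat_rev /= add0n.
rewrite -[X in _ + \sum_(X <= i < _) _]add0n big_addn.
have -> : ((N + N).+1 - N = N.+1)%N by lia.
rewrite (@eq_big_nat _ _ _ 0 N _ (fun i => f i.+1)); last first.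
  by move=> i iN; congr f; lia.
rewrite (@eq_big_nat _ _ _ 0 N.+1 _ f); last by move=> i iN; congr f; lia.
rewrite big_nat_recl // big_ord_recl /= mulr1n addrCA; congr (_ + _).
rewrite !big_mkord -big_split /=; apply: eq_bigr => i _.
by rewrite mulr2n.
Qed.

Section representations.
Variables (n N : nat) (m : int).
Hypothesis mN : m <= (N ^ 2)%:Z.

Let vec (u : {ffun 'I_n -> 'I_(N + N).+1}) : n.-tuple int :=
  [tuple (u i)%:Z - N%:Z | i < n].

Let vec_inj : injective vec.
Proof.
move=> u v uv; apply/ffunP => i; apply/val_inj.
have := congr1 (fun x => tnth x i) uv; rewrite !tnth_mktuple => /addIr.
by case.
Qed.

(** Each square in a representation is at most [m <= N ^ 2], so coordinates lie in [[-N, N]] and a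
    shift by [N] makes them ordinals. Finite functions are the index set produced by expanding a
    power of a sum. *)
Lemma r_card_box :
  r_ n m = #|[pred u : {ffun 'I_n -> 'I_(N + N).+1} |
    \sum_i (((absz ((u i)%:Z - N%:Z)) ^ 2)%N)%:Z == m]|.
Proof.
rewrite /r_ cardE -(size_map vec); apply: perm_size.
apply: uniq_perm; [exact: fset_uniq|by rewrite map_inj_uniq ?enum_uniq|].
move=> x; rewrite in_fset_set; last exact: sq_reps_finite.
have sqE (u : {ffun 'I_n -> 'I_(N + N).+1}) :
    \sum_(i < n) tnth (vec u) i ^+ 2 =
    \sum_i (((absz ((u i)%:Z - N%:Z)) ^ 2)%N)%:Z.
  apply: eq_bigr => i _; rewrite tnth_mktuple -mulnn PoszM -expr2.
  by rewrite abszE real_normK // num_real.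
apply/idP/mapP => [|[u]]; rewrite ?inE /sq_reps /=; last first.
  by rewrite mem_enum !inE => /eqP um ->; rewrite sqE.
move=> xm.
have xN i : (absz (tnth x i) <= N)%N.
  rewrite -leq_sqr -lez_nat; apply: le_trans mN.
  rewrite -xm (bigD1 i) //= -mulnn PoszM -expr2 abszE real_normK ?num_real //.
  by rewrite lerDl sumr_ge0 // => j _; exact: sqr_ge0.
pose u := [ffun i => inord (absz (tnth x i + N%:Z)) : 'I_(N + N).+1].
have xu : x = vec u.
  apply: eq_from_tnth => i; rewrite tnth_mktuple ffunE inordK; last first.
    by have := xN i; lia.
  by have := xN i; lia.
exists u => //; rewrite mem_enum !inE; apply/eqP.
by rewrite -sqE -xu.
Qed.

End representations.

(** * Fourier inversion *)

Lemma is_derive_big (R : realType) (I : Type) (r : seq I) (f : I -> R -> R)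
    (df : I -> R) (x : R) :
  (forall i, is_derive x 1 (f i) (df i)) ->
  is_derive x 1 (fun y => \sum_(i <- r) f i y) (\sum_(i <- r) df i).
Proof.
move=> fdf; elim: r => [|i r IH].
  rewrite big_nil; have -> : (fun y => \sum_(i <- [::]) f i y) = cst (0 : R).
    by apply/funext => y; rewrite big_nil.
  exact: is_derive_cst.
rewrite big_cons.
have -> : (fun y => \sum_(j <- i :: r) f j y) = f i + (fun y => \sum_(j <- r) f j y).
  by apply/funext => y; rewrite big_cons.
exact: is_deriveD.
Qed.

Lemma integral_derive (R : realType) (f df : R -> R) (a b : R) :
  a < b -> (forall x : R, is_derive x 1 f (df x)) -> continuous df ->
  (\int[lebesgue_measure]_(x in `[a, b]) (df x)%:E = (f b - f a)%:E)%E.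
Proof.
move=> ab fdf cdf; rewrite EFinB; apply: continuous_FTC2 => //.
- exact: continuous_subspaceT.
- have cf := is_derive_continuous fdf; split.
  + by move=> x _; case: (fdf x).
  + by apply: cvg_at_right_filter; exact: cf.
  + by apply: cvg_at_left_filter; exact: cf.
- by move=> x _; rewrite derive1E; have [_ ->] := fdf x.
Qed.

Lemma sin_intr_pi (R : realType) (k : int) : sin (k%:~R * pi) = 0 :> R.
Proof.
have nat_case (n : nat) : sin (n%:R * pi) = 0 :> R.
  elim: n => [|n IH]; first by rewrite mul0r sin0.
  by rewrite -natr1 mulrDl mul1r sinDpi IH oppr0.
case: k => n; first exact: nat_case.
by rewrite NegzE mulrNz mulNr sinN nat_case oppr0.
Qed.

Section trigonometric_sum.
Context {R : realType}.
Variables (I : finType) (W : I -> R) (k : I -> int) (c : R).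

Definition cos_sum (s : R) : R := \sum_i W i * cos ((k i)%:~R * (s / c)).

Lemma continuous_cos_sum : continuous cos_sum.
Proof.
apply: (@is_derive_continuous _ _ (fun s => \sum_i (W i *
  (- sin ((k i)%:~R * (s / c)) * ((k i)%:~R / c))))) => x.
apply: is_derive_big => i.
apply: is_derive_eq; rewrite /GRing.scale /=; ring.
Qed.

(** Orthogonality: a term of nonzero frequency has a sine primitive that vanishes at both endpoints,
    where its argument is an integer multiple of [pi]. *)
Lemma integral_cos_sum : 0 < c ->
  (\int[lebesgue_measure]_(s in `[(- (pi * c))%R, (pi * c)%R]) (cos_sum s)%:E
    = (2 * pi * c * \sum_(i | k i == 0) W i)%R%:E)%E.
Proof.
move=> c0; have cn0 : c != 0 by rewrite gt_eqF.
have pc0 : 0 < pi * c by rewrite mulr_gt0 // pi_gt0.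
pose F i s := W i * (if k i == 0 then s
  else sin ((k i)%:~R * (s / c)) * (c / (k i)%:~R)).
have dF (s : R) : is_derive s 1 (fun s => \sum_i F i s) (cos_sum s).
  apply: is_derive_big => i; rewrite /F; case: eqP => [->|/eqP k0].
    by apply: is_derive_eq; rewrite /GRing.scale /= mul0r cos0; ring.
  have kn0 : (k i)%:~R != 0 :> R by rewrite intr_eq0.
  by apply: is_derive_eq; rewrite /GRing.scale /=; field; rewrite ?cn0 ?kn0.
rewrite (integral_derive _ dF continuous_cos_sum) ?gtrN //.
congr EFin; rewrite -sumrB [in RHS]big_mkcond /= mulr_sumr; apply: eq_bigr => i _.
rewrite /F; case: eqP => [_|_]; first by ring.
by rewrite mulNr mulfK // mulrN sinN sin_intr_pi !mul0r; ring.
Qed.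

End trigonometric_sum.

Section inversion.
Context {R : realType}.
Variables (n N : nat) (m : int) (q th : R).
Local Open Scope complex_scope.

(** When [th] is the theta constant, this is the probability that the tilted integer has absolute
    value [j]. *)
Definition theta_weight (j : nat) : R := (abs_mult j)%:R * q ^+ (j ^ 2) / th.

(** The characteristic function restricted to absolute values at most [N]. The frequencies [y] are a
    parameter so that both [j ^ 2] and the centred [j ^ 2 - a] can be used. *)
Definition trunc_char (y : nat -> R) (t : R) : R[i] :=
  \sum_(j < N.+1) (theta_weight j)%:C * cis (y j * t).

Let d (i : 'I_(N + N).+1) : nat := (absz (i%:Z - N%:Z) ^ 2)%N.
Let W (u : {ffun 'I_n -> 'I_(N + N).+1}) : R := \prod_i (q ^+ d (u i) / th).
Let k (u : {ffun 'I_n -> 'I_(N + N).+1}) : int := \sum_i (d (u i))%:Z - m.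

Let trunc_charE (y : nat -> R) t :
  trunc_char y t = \sum_(i < (N + N).+1)
    (q ^+ d i / th)%:C * cis (y (absz (i%:Z - N%:Z)) * t).
Proof.
rewrite (@sum_abs_fold _ (fun j => (q ^+ (j ^ 2) / th)%:C * cis (y j * t))).
apply: eq_bigr => j _; rewrite /theta_weight -mulrA mulr_natl rmorphMn /=.
by rewrite mulrnAl.
Qed.

Lemma Re_trunc_charX (c s : R) :
  complex.Re (cis (- (m%:~R * (s / c))) *
    trunc_char (fun j => (j ^ 2)%:R) (s / c) ^+ n) = cos_sum W k c s.
Proof.
rewrite trunc_charE /cos_sum.
rewrite -[X in _ ^+ X](card_ord n) -prodr_const bigA_distr_bigA /= mulr_sumr Re_sum.
apply: eq_bigr => u _.
rewrite big_split /= -rmorph_prod /= mulrCA Re_realM -cis_sum -cisD /=.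
congr (_ * cos _); rewrite /k rmorphB /= rmorph_sum /= mulrBl mulr_suml.
by rewrite addrC.
Qed.

(** Expanding the [n]-th power gives one cosine per box point, and integration keeps those whose
    squares sum to [m], each of weight [q ^ m / th ^+ n]. The truncation at [N] is exact here, and
    the scale [c] will be [sqrt n]. *)
Lemma r_integral (c : R) : m <= (N ^ 2)%:Z -> 0 < c ->
  (\int[lebesgue_measure]_(s in `[(- (pi * c))%R, (pi * c)%R])
     (complex.Re (cis (- (m%:~R * (s / c))) *
        trunc_char (fun j => (j ^ 2)%:R) (s / c) ^+ n))%R%:E
   = (2 * pi * c * ((r_ n m)%:R * q ^ m / th ^+ n))%R%:E)%E.
Proof.
move=> mN c0; under eq_integral do rewrite Re_trunc_charX.
rewrite integral_cos_sum //; congr (_ * _)%:E.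
rewrite (r_card_box n mN) -sum1_card natr_sum !mulr_suml.
apply: eq_big => [u|u]; rewrite /k subr_eq0 //.
move=> /eqP um; rewrite mul1r /W big_split /= prodr_const card_ord exprVn.
congr (_ * _); rewrite -um.
by rewrite -(big_morph Posz PoszD (erefl 0%:Z)) -exprnP prodrXr.
Qed.

Lemma continuous_Re_trunc_charX (c : R) :
  continuous (fun s : R => complex.Re (cis (- (m%:~R * (s / c))) *
    trunc_char (fun j => (j ^ 2)%:R) (s / c) ^+ n)).
Proof.
by rewrite (funext (Re_trunc_charX c)); exact: continuous_cos_sum.
Qed.

End inversion.

Lemma series_le_lim (R : realType) (f : R^nat) n :
  (forall j, 0 <= f j) -> cvgn (series f) -> series f n <= limn (series f).
Proof.
move=> f0 cf; apply: nondecreasing_cvgn_le => //.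
by apply: nondecreasing_series => j _ _; exact: f0.
Qed.

(** * Gaussian integrals *)

Section gaussian.
Context {R : realType}.
Variable k : R.
Hypothesis k_gt0 : 0 < k.
(** The standard deviation at which the normal density is a constant multiple of
    [expR (- (k * s ^+ 2))]. *)
Let tau : R := (Num.sqrt (2 * k))^-1.

Let tau_neq0 : tau != 0.
Proof. by rewrite invr_neq0 // gt_eqF // sqrtr_gt0 mulr_gt0. Qed.

Let gaussianE (s : R) :
  (expR (- (k * s ^+ 2)))%:E =
  ((normal_peak tau)^-1%:E * (normal_pdf 0 tau s)%:E)%E.
Proof.
rewrite normal_pdfE // -EFinM mulKf ?gt_eqF ?normal_peak_gt0 //.
rewrite /normal_fun subr0 /tau exprVn sqr_sqrtr ?mulr_ge0 ?ltW //.
by congr (expR _)%:E; rewrite -mulr_natr; field; rewrite gt_eqF.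
Qed.

Lemma integrable_gaussian : lebesgue_measure.-integrable setT
  (fun s : R => (expR (- (k * s ^+ 2)))%:E).
Proof.
rewrite (funext gaussianE); apply: integrableZl => //.
exact: integrable_normal_pdf.
Qed.

Lemma integral_gaussian : exists2 G : R, 0 < G &
  (\int[lebesgue_measure]_s (expR (- (k * s ^+ 2)))%:E = G%:E)%E.
Proof.
exists (normal_peak tau)^-1; first by rewrite invr_gt0 normal_peak_gt0.
under eq_integral do rewrite gaussianE.
by rewrite integralZl // ?integral_normal_pdf ?mule1 //; exact: integrable_normal_pdf.
Qed.

End gaussian.

(** * The local limit theorem *)

Definition theta (R : realType) (q : R) : R :=
  limn (series (fun j => (abs_mult j)%:R * q ^+ (j ^ 2))).

Section local_limit.
Context {R : realType}.
Variables (a : nat) (q : R).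
Hypotheses (a_gt0 : (0 < a)%N) (q01 : 0 < q < 1)
  (tilt : limn (series (tilt_term a q)) = 0).
Import Normc.
Local Open Scope complex_scope.

Let th : R := theta q.
Let w j : R := theta_weight q th j.
Let y (j : nat) : R := (j ^ 2)%:R - a%:R.

Let q_gt0 : 0 < q. Proof. by case/andP: q01. Qed.

Let theta_term_ge0 j : 0 <= (abs_mult j)%:R * q ^+ (j ^ 2).
Proof. by rewrite mulr_ge0 // exprn_ge0 // ltW. Qed.

Let is_cvg_theta : cvgn (series (fun j => (abs_mult j)%:R * q ^+ (j ^ 2))).
Proof.
have [C [r [r01 b]]] := @gaussian_moment_geometric R a 0 q q01.
apply: (is_cvg_series_geometric_bound r01) => j.
by rewrite ger0_norm //; have := b j; rewrite expr0 mulr1; exact.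
Qed.

Lemma theta_gt0 : 0 < th.
Proof.
apply: (@lt_le_trans _ _ 1) => //.
apply: le_trans (series_le_lim 1 theta_term_ge0 is_cvg_theta).
by rewrite /series /= big_nat1 /abs_mult /= mul1r.
Qed.

Let w_ge0 j : 0 <= w j.
Proof. by rewrite /w /theta_weight divr_ge0 // ltW // theta_gt0. Qed.

Let w_gt0 j : 0 < w j.
Proof.
rewrite /w /theta_weight divr_gt0 ?theta_gt0 // mulr_gt0 ?exprn_gt0 //.
by rewrite ltr0n /abs_mult; case: ifP.
Qed.

Let w_moment m : exists C r : R, 0 < r < 1 /\
  forall j, w j * (j ^ 2 + a)%:R ^+ m <= C * r ^+ j.
Proof.
have [C [r [r01 b]]] := @gaussian_moment_geometric R a m q q01.
exists (C / th), r; split=> // j.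
have -> : w j * (j ^ 2 + a)%:R ^+ m =
    (abs_mult j)%:R * (j ^ 2 + a)%:R ^+ m * q ^+ (j ^ 2) / th.
  by rewrite /w /theta_weight; ring.
by rewrite [leRHS]mulrAC ler_wpM2r // invr_ge0 ltW // theta_gt0.
Qed.

(** The terms of the [m]-th moment of [x ^ 2 - a] under the tilted law. *)
Let mom m j : R := w j * y j ^+ m.

Let norm_mom_le m j : `|mom m j| <= w j * (j ^ 2 + a)%:R ^+ m.
Proof.
rewrite /mom normrM ger0_norm // ler_wpM2l // normrX lerXn2r ?nnegrE //.
exact: norm_sqr_sub_le.
Qed.

Let mom_geometric m : exists C r : R, 0 < r < 1 /\
  forall j, `|mom m j| <= C * r ^+ j.
Proof.
have [C [r [r01 b]]] := w_moment m; exists C, r; split=> // j.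
exact: le_trans (norm_mom_le m j) (b j).
Qed.

Let is_cvg_mom m : cvgn (series (mom m)).
Proof. by have [C [r [r01 /(is_cvg_series_geometric_bound r01)]]] := mom_geometric m. Qed.

Let abs_mom_bounded m : exists C : R, forall n, \sum_(j < n) w j * `|y j| ^+ m <= C.
Proof.
have [C [r [r01 b]]] := mom_geometric m.
have cv : cvgn (series (fun j => w j * `|y j| ^+ m)).
  apply: (is_cvg_series_geometric_bound r01) => j; apply: le_trans (b j).
  by rewrite /mom !normrM !normrX normr_id.
exists (limn (series (fun j => w j * `|y j| ^+ m))) => n.
rewrite -(big_mkord xpredT (fun j => w j * `|y j| ^+ m)).
by apply: (series_le_lim n) => // j; rewrite mulr_ge0 ?exprn_ge0.
Qed.

Let series_scale (f : R^nat) (c : R) : cvgn (series f) ->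
  limn (series (fun j => f j / c)) = limn (series f) / c.
Proof.
move=> cf; apply/cvg_lim => //.
rewrite [X in X @ _ --> _](_ : _ = fun n => series f n / c).
  by apply: cvgMl.
by apply/funext => n; rewrite /series /= mulr_suml.
Qed.

Let lim_mom0 : limn (series (mom 0)) = 1.
Proof.
have -> : mom 0 = fun j => (abs_mult j)%:R * q ^+ (j ^ 2) / th.
  by apply/funext => j; rewrite /mom expr0 mulr1.
by rewrite series_scale // divff // gt_eqF // theta_gt0.
Qed.

(** The choice of [q] enters here: centring at [a] removes the linear term of the characteristic
    function. *)
Let lim_mom1 : limn (series (mom 1)) = 0.
Proof.
have mE : mom 1 = fun j => tilt_term a q j / th.
  by apply/funext => j; rewrite /mom expr1 /w /theta_weight /tilt_term /y; ring.
suff cvt : cvgn (series (tilt_term a q)).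
  by rewrite mE (@series_scale (tilt_term a q)) // tilt mul0r.
have [C [r [r01 b]]] := @gaussian_moment_geometric R a 1 q q01.
apply: (is_cvg_series_geometric_bound r01) => j; apply: le_trans (b j).
rewrite /tilt_term !normrM normr_nat (gtr0_norm (exprn_gt0 _ q_gt0)).
by rewrite ler_wpM2r ?exprn_ge0 ?(ltW q_gt0) // ler_wpM2l // norm_sqr_sub_le.
Qed.

Let var : R := limn (series (mom 2)).

(** The term [j = 0] alone contributes [w 0 * a ^ 2 > 0]. *)
Let var_gt0 : 0 < var.
Proof.
have m0 j : 0 <= mom 2 j by rewrite /mom mulr_ge0 // sqr_ge0.
apply: lt_le_trans (series_le_lim 1 m0 (@is_cvg_mom 2)).
rewrite /series /= big_nat1 /mom mulr_gt0 // exprn_even_gt0 //=.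
by rewrite /y sub0r oppr_eq0 pnatr_eq0 -lt0n.
Qed.

Let sum_w_le1 n : \sum_(j < n) w j <= 1.
Proof.
have -> : \sum_(j < n) w j = series (mom 0) n.
  by rewrite /series /= big_mkord; apply: eq_bigr => j _; rewrite /mom expr0 mulr1.
rewrite -lim_mom0; apply: series_le_lim => // j.
by rewrite /mom expr0 mulr1.
Qed.

Variable b : int.

(* Coordinates of a representation of [a n + b] are at most [M n] in absolute
   value, so only a finite part of the theta series is needed at stage [n]. *)
Let M n : nat := (n + (a + absz b)).+1.
Let psi n (t : R) : R[i] := trunc_char (M n) q th y t.

Let sqM n : a%:Z * n%:Z + b <= ((M n) ^ 2)%:Z.
Proof.
have : b <= (absz b)%:Z by rewrite abszE ler_norm.
rewrite /M; set B := absz b => bB; apply: (@le_trans _ _ (a%:Z * n%:Z + B%:Z)).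
  by rewrite lerD2l.
by rewrite -PoszM -PoszD lez_nat; nia.
Qed.

(** The part [a n] of the phase is spread over the [n] factors, where it centres the frequencies;
    only the fixed shift [b] remains outside. *)
Let trunc_char_center n (t : R) :
  cis (- ((a%:Z * n%:Z + b)%:~R * t)) *
    trunc_char (M n) q th (fun j => (j ^ 2)%:R) t ^+ n =
  cis (- (b%:~R * t)) * psi n t ^+ n.
Proof.
have -> : psi n t = cis (- (a%:R * t)) *
    trunc_char (M n) q th (fun j => (j ^ 2)%:R) t.
  rewrite /psi /trunc_char mulr_sumr; apply: eq_bigr => j _.
  by rewrite /y mulrBl addrC cisD mulrCA.
rewrite exprMn -cis_natM mulrA -cisD; congr (cis _ * _).
by rewrite rmorphD rmorphM /=; ring.
Qed.

(** The decay rate from [normc_cis_sum_le], which is independent of the truncation. *)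
Let kappa : R := w 0%N * w 1%N / (w 0%N + w 1%N) / 18.

Let kappa_gt0 : 0 < kappa.
Proof. by rewrite /kappa !divr_gt0 // ?addr_gt0 // mulr_gt0. Qed.

Let psi_bound n (t : R) : `|t| <= pi -> normc (psi n t) <= expR (- (kappa * t ^+ 2)).
Proof.
move=> tpi; apply: le_trans (expR_ge1Dx _).
apply: (@normc_cis_sum_le R w y) => //.
by rewrite /y !natrX expr0n expr1n /= sub0r addrC.
Qed.

Let psi_le1 n (t : R) : normc (psi n t) <= 1.
Proof.
apply: le_trans (sum_w_le1 (M n).+1); apply: (le_trans (ler_normc_sum _ _ _)).
by apply: ler_sum => j _; rewrite normcM normc_cis normc_real ger0_norm ?mulr1.
Qed.

Let sqrtn (n : nat) : R := Num.sqrt n%:R.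

Let sqr_sqrtn n : sqrtn n ^+ 2 = n%:R.
Proof. by rewrite sqr_sqrtr. Qed.

Let sqrtn_gt0 n : (0 < n)%N -> 0 < sqrtn n.
Proof. by move=> n0; rewrite sqrtr_gt0 ltr0n. Qed.

Let Re_psi n t : complex.Re (psi n t) = \sum_(j < (M n).+1) w j * cos (y j * t).
Proof. by rewrite /psi /trunc_char Re_sum; apply: eq_bigr => j _; rewrite Re_realM. Qed.

Let Im_psi n t : complex.Im (psi n t) = \sum_(j < (M n).+1) w j * sin (y j * t).
Proof. by rewrite /psi /trunc_char Im_sum; apply: eq_bigr => j _; rewrite Im_realM. Qed.

(** Second-order expansion of the cosine at [t = s / sqrt n]: the truncated mass tends to 1 with
    error [o(1/n)], the second moment gives the limit, and the quartic remainder is [O(1/n)] after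
    multiplication by [n]. *)
Let cvg_Re_psi (s : R) :
  n%:R * (complex.Re (psi n (s / sqrtn n)) - 1) @[n --> \oo] --> - (var / 2 * s ^+ 2).
Proof.
have [C4 hC4] := abs_mom_bounded 4.
pose g n := - (n%:R * (limn (series (mom 0)) - series (mom 0) (M n).+1))
  - series (mom 2) (M n).+1 / 2 * s ^+ 2.
have nM n : (n <= (M n).+1)%N by rewrite /M; lia.
have cg : g n @[n --> \oo] --> - (var / 2 * s ^+ 2).
  rewrite -[X in _ --> X]add0r -[X in _ --> X + _]oppr0; apply: cvgB.
    apply: cvgN; have [C [r [r01 hb]]] := mom_geometric 0.
    exact: cvg_natr_series_geometric_tail r01 hb _ nM.
  apply: cvgMl; apply: cvgMl.
  have : (fun n => (M n).+1) @ \oo --> \oo.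
    apply/cvgnyPge => k; near=> n; apply: leq_trans (nM n).
    by near: n; exact: nbhs_infty_ge.
  by move=> /cvg_comp; apply; exact: is_cvg_mom.
have d0 : n%:R * (complex.Re (psi n (s / sqrtn n)) - 1) - g n
    @[n --> \oo] --> (0 : R).
  apply/norm_cvg0P.
  apply: (@squeeze_cvgr _ _ _ _ (fun=> 0) (fun n => s ^+ 4 * C4 * n%:R^-1)).
  - near=> n; rewrite normr_ge0 /=.
    have n0 : (0 < n)%N by near: n; exact: nbhs_infty_gt.
    have sn0 : sqrtn n != 0 by rewrite gt_eqF // sqrtn_gt0.
    set t := s / sqrtn n.
    have -> : n%:R * (complex.Re (psi n t) - 1) - g n =
      n%:R * \sum_(j < (M n).+1) w j * (cos (y j * t) - (1 - (y j * t) ^+ 2 / 2)).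
      rewrite /g lim_mom0 /series /= !big_mkord Re_psi.
      have -> : s ^+ 2 = n%:R * t ^+ 2 by rewrite -sqr_sqrtn /t; field.
      have -> : \sum_(j < (M n).+1) w j * (cos (y j * t) - (1 - (y j * t) ^+ 2 / 2)) =
        \sum_(j < (M n).+1) w j * cos (y j * t)
        - \sum_(j < (M n).+1) mom 0 j + (\sum_(j < (M n).+1) mom 2 j) * (t ^+ 2 / 2).
        rewrite mulr_suml -sumrB -big_split /=; apply: eq_bigr => j _.
        by rewrite /mom; ring.
      by ring.
    rewrite normrM normr_nat.
    have -> : s ^+ 4 * C4 / n%:R = n%:R * (t ^+ 4 * C4).
      by rewrite -sqr_sqrtn /t; field.
    rewrite ler_wpM2l // (le_trans (ler_norm_sum _ _ _)) //.
    apply: (@le_trans _ _ (t ^+ 4 * \sum_(j < (M n).+1) w j * `|y j| ^+ 4)).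
      rewrite mulr_sumr; apply: ler_sum => j _.
      rewrite normrM (ger0_norm (w_ge0 _)) [leRHS]mulrCA ler_wpM2l //.
      apply: (le_trans (cos_taylor _)).
      by rewrite -normrX (ger0_norm (exprn_even_ge0 _ _)) // exprMn mulrC.
    by rewrite ler_wpM2l ?exprn_even_ge0.
  - exact: cvg_cst.
  - by rewrite -[X in _ --> X](mulr0 (s ^+ 4 * C4)); apply: cvgMr; exact: cvg_natrV.
rewrite -[X in _ --> X]add0r.
have -> : (fun n => n%:R * (complex.Re (psi n (s / sqrtn n)) - 1)) =
    (fun n => n%:R * (complex.Re (psi n (s / sqrtn n)) - 1) - g n + g n).
  by apply/funext => n; rewrite subrK.
exact: cvgD d0 cg.
Unshelve. all: by end_near. Qed.

(** As the full first moment vanishes, the linear term of the sine is only a truncation tail, and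
    the cubic remainder is [O(1 / sqrt n)] after multiplication by [n]. *)
Let cvg_Im_psi (s : R) :
  n%:R * complex.Im (psi n (s / sqrtn n)) @[n --> \oo] --> (0 : R).
Proof.
have [C3 hC3] := abs_mom_bounded 3.
pose g n := `|s| * `|n%:R * (limn (series (mom 1)) - series (mom 1) (M n).+1)|.
have nM n : (n <= (M n).+1)%N by rewrite /M; lia.
have cg : g n @[n --> \oo] --> (0 : R).
  rewrite -[X in _ --> X](mulr0 `|s|); apply: cvgMr; apply/norm_cvg0P.
  have [C [r [r01 hb]]] := mom_geometric 1.
  exact: cvg_natr_series_geometric_tail r01 hb _ nM.
apply/norm_cvg0P.
apply: (@squeeze_cvgr _ _ _ _ (fun=> 0) (fun n => g n + `|s| ^+ 3 * C3 * (sqrtn n)^-1)).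
- near=> n; rewrite normr_ge0 /=.
  have n0 : (0 < n)%N by near: n; exact: nbhs_infty_gt.
  have sn_gt0 := sqrtn_gt0 n0.
  have sn0 : sqrtn n != 0 by rewrite gt_eqF.
  set t := s / sqrtn n.
  have -> : n%:R * complex.Im (psi n t) = n%:R * (t * \sum_(j < (M n).+1) mom 1 j) +
     n%:R * \sum_(j < (M n).+1) w j * (sin (y j * t) - y j * t).
    rewrite -mulrDr Im_psi; congr (_ * _); rewrite mulr_sumr -big_split /=.
    by apply: eq_bigr => j _; rewrite /mom; ring.
  apply: (le_trans (ler_normD _ _)); apply: lerD.
    have ts : `|t| <= `|s|.
      rewrite /t normrM normfV (gtr0_norm sn_gt0) ler_piMr // invf_le1 //.
      by rewrite -(@sqrtr1 R) ler_sqrt // ler1n.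
    rewrite /g lim_mom1 sub0r mulrN normrN /series /= big_mkord mulrCA.
    by rewrite [leLHS]normrM ler_wpM2r.
  rewrite normrM normr_nat.
  have -> : `|s| ^+ 3 * C3 / sqrtn n = n%:R * (`|t| ^+ 3 * C3).
    by rewrite -sqr_sqrtn /t normrM normfV (gtr0_norm sn_gt0); field.
  rewrite ler_wpM2l // (le_trans (ler_norm_sum _ _ _)) //.
  apply: (@le_trans _ _ (`|t| ^+ 3 * \sum_(j < (M n).+1) w j * `|y j| ^+ 3)).
    rewrite mulr_sumr; apply: ler_sum => j _.
    rewrite normrM (ger0_norm (w_ge0 _)) [leRHS]mulrCA ler_wpM2l //.
    by apply: (le_trans (sin_taylor _)); rewrite normrM exprMn mulrC.
  by rewrite ler_wpM2l // exprn_ge0.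
- exact: cvg_cst.
- rewrite -[X in _ --> X]addr0; apply: cvgD => //.
  rewrite -[X in _ --> X](mulr0 (`|s| ^+ 3 * C3)); apply: cvgMr.
  exact: cvg_sqrt_natrV.
Unshelve. all: by end_near. Qed.

Let phi n (s : R) : R :=
  complex.Re (cis (- (b%:~R * (s / sqrtn n))) * psi n (s / sqrtn n) ^+ n).

Let cvg_phi (s : R) : phi n s @[n --> \oo] --> expR (- (var / 2 * s ^+ 2)).
Proof.
apply: (@cvg_Re_cis_exp R (fun n => psi n (s / sqrtn n))
  (fun n => - (b%:~R * (s / sqrtn n)))).
- by move=> n; exact: psi_le1.
- by rewrite oppr_le0 mulr_ge0 ?sqr_ge0 // divr_ge0 // ltW.
- exact: cvg_Re_psi.
- exact: cvg_Im_psi.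
- rewrite -oppr0 -(mulr0 b%:~R) -(mulr0 s); apply: cvgN; apply: cvgMr.
  by apply: cvgMr; exact: cvg_sqrt_natrV.
Qed.

Let phi_bound n (s : R) : `|s| <= pi * sqrtn n ->
  `|phi n s| <= expR (- (kappa * s ^+ 2)).
Proof.
move=> spi; apply: (le_trans (ler_normRe _)).
rewrite normcM normc_cis mul1r normcX.
(* At [n = 0] the range of [s] is the single point 0, where both sides are 1 at most; domination
   thus holds for every [n]. *)
have [n0|n0] := posnP n.
  have -> : s = 0.
    by apply/eqP; rewrite -normr_le0 (le_trans spi) // n0 /sqrtn sqrtr0 mulr0.
  by rewrite n0 expr0 expr0n mulr0 oppr0 expR0.
have sn_gt0 := sqrtn_gt0 n0.
have tpi : `|s / sqrtn n| <= pi.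
  by rewrite normrM normfV (gtr0_norm sn_gt0) ler_pdivrMr.
have -> : expR (- (kappa * s ^+ 2)) = expR (- (kappa * (s / sqrtn n) ^+ 2)) ^+ n.
  rewrite -expRM_natl -sqr_sqrtn; congr expR; field.
  by rewrite gt_eqF.
by rewrite lerXn2r ?nnegrE ?normc_ge0 ?expR_ge0 // psi_bound.
Qed.

Let D n : set R := `[- (pi * sqrtn n), pi * sqrtn n].

Let phiE n s : phi n s = complex.Re (cis (- ((a%:Z * n%:Z + b)%:~R * (s / sqrtn n))) *
  trunc_char (M n) q th (fun j => (j ^ 2)%:R) (s / sqrtn n) ^+ n).
Proof. by rewrite /phi trunc_char_center. Qed.

(** Dominated convergence for the rescaled inversion integral: [cvg_phi] gives the pointwise limit
    and [phi_bound] the Gaussian majorant. Inversion at scale [sqrt n] leaves the factor [2 pi],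
    which divides the limiting Gaussian integral. *)
Lemma cvg_r_normalized : exists2 G : R, 0 < G &
  sqrtn n * ((r_ n (a%:Z * n%:Z + b))%:R * q ^ (a%:Z * n%:Z + b) / th ^+ n)
    @[n --> \oo] --> G.
Proof.
have v2 : 0 < var / 2 by rewrite divr_gt0.
have [G G0 GE] := integral_gaussian v2.
exists (G / (2 * pi)); first by rewrite divr_gt0 // mulr_gt0 // pi_gt0.
pose f n : R -> \bar R := (EFin \o phi n) \_ (D n).
have mD n : measurable (D n) by exact: measurable_itv.
have fE n (s : R) : f n s = if s \in D n then (phi n s)%:E else 0%E by [].
(* A fixed [s] lies in [D n] for all large [n], so extension by zero does not affect the pointwise
   limit. *)
have fpt (s : R) : f n s @[n --> \oo] --> (expR (- (var / 2 * s ^+ 2)))%:E.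
  apply: cvg_EFin; first by apply: nearW => n; rewrite fE; case: ifP.
  apply: cvg_trans (@cvg_phi s); apply: near_eq_cvg; near=> n.
  rewrite /= fE ifT // inE /D /= in_itv /= -ler_norml.
  have n0 : (0 < n)%N by near: n; exact: nbhs_infty_gt.
  rewrite -ler_pdivrMr ?sqrtn_gt0 // ltW //; near: n.
  have : `|s| / sqrtn n @[n --> \oo] --> (0 : R).
    by rewrite -(mulr0 `|s|); apply: cvgMr; exact: cvg_sqrt_natrV.
  by move=> /cvgr_lt; apply; exact: pi_gt0.
have If : (\int[lebesgue_measure]_s f n s)%E @[n --> \oo] --> G%:E.
  rewrite -GE; apply: (@dominated_cvg _ _ R lebesgue_measure setT measurableT f
    _ (fun s => (expR (- (kappa * s ^+ 2)))%:E)) => //.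
  - move=> n; have mphi : measurable_fun setT (phi n).
      apply: continuous_measurable_fun; rewrite (funext (phiE n)).
      exact: continuous_Re_trunc_charX.
    apply: (measurable_restrictT (EFin \o phi n) (mD n)).1.
    by apply/measurable_EFinP; exact: measurable_funTS mphi.
  - exact: integrable_gaussian.
  - move=> n s _; rewrite fE; case: ifPn => sD; last by rewrite abse0 lee_fin expR_ge0.
    rewrite lee_fin phi_bound //; move: sD; rewrite inE /D /= in_itv /= => sD.
    by rewrite ler_norml.
have cvI : fine (\int[lebesgue_measure]_s f n s)%E / (2 * pi)
    @[n --> \oo] --> G / (2 * pi).
  by apply: cvgMl; exact: fine_cvg If.
apply: cvg_trans cvI; apply: near_eq_cvg; near=> n.
have n0 : (0 < n)%N by near: n; exact: nbhs_infty_gt.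
rewrite /= /f -integral_mkcond /=.
under eq_integral do rewrite phiE.
rewrite (@r_integral _ _ (M n)) ?sqrtn_gt0 ?sqM //=.
set X := (_ / th ^+ n); have tpi_neq0 : 2 * pi != 0 :> R.
  by rewrite mulf_neq0 // gt_eqF // pi_gt0.
by rewrite -[2 * pi * _ * _]mulrA mulrC mulKf.
Unshelve. all: by end_near. Qed.

End local_limit.

(** * The asymptotic formula *)

Theorem theorem1p1 (R : realType) (a : nat) (ha : (0 < a)%N) :
  exists A : R, forall b : int, exists B : R,
    (r_ n (a%:Z * n%:Z + b))%:R / (B * A ^+ n / Num.sqrt n%:R)
      @[n --> \oo] --> (1 : R).
Proof.
have [q q01 tilt] := @exists_tilt R a ha.
have q_neq0 : q != 0 by case/andP: q01 => q0 _; rewrite gt_eqF.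
have th_neq0 : theta q != 0 by rewrite gt_eqF // theta_gt0.
(* The parameter [q] was fixed from [a] alone. Solving the normalised limit for the count splits
   [q ^ (a n + b)]: its part [(q ^+ a) ^+ n] joins the exponential base, and [q ^ b] goes into
   [B]. *)
exists (theta q / q ^+ a) => b.
have [G G0 cvG] := @cvg_r_normalized R a q ha q01 tilt b.
have G_neq0 : G != 0 by rewrite gt_eqF.
exists (G / q ^ b).
have h : Num.sqrt n%:R * ((r_ n (a%:Z * n%:Z + b))%:R *
    q ^ (a%:Z * n%:Z + b) / theta q ^+ n) / G @[n --> \oo] --> (1 : R).
  by rewrite -[X in _ --> X](divff G_neq0); apply: cvgMl; exact: cvG.
apply: cvg_trans h; apply: near_eq_cvg; near=> n.
have sn0 : Num.sqrt n%:R != 0 :> R.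
  by rewrite gt_eqF // sqrtr_gt0 ltr0n; near: n; exact: nbhs_infty_gt.
rewrite expfzDr // -PoszM -exprnP exprM exprMn exprVn.
have qb0 : q ^ b != 0 by rewrite expfz_neq0.
have qa0 : q ^+ a ^+ n != 0 by rewrite !expf_neq0.
have tn0 : theta q ^+ n != 0 by rewrite expf_neq0.
field; rewrite ?sn0 ?qb0 ?qa0 ?tn0 ?G_neq0 //.
Unshelve. all: by end_near. Qed.
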